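(* Let $v\in\mathbb{N}$ and $n=2^a$ for some $a\in\mathbb{Z}^+$. Define rational polynomials $y_v(k)$ by $y_0(k)=-\tfrac12$ and, for $v\ge1$, $y_v(k)=-\tfrac12(2k+3)^{2v}+\sum_{j=1}^{v}e_j^{(2v)}y_{v-j}(k)$; and $\tilde y_v(k)$ by $\tilde y_0(k)=\tfrac14$ and, for $v\ge1$, $\tilde y_v(k)=\tfrac14(2k+3)^{2v}-\sum_{j=1}^{v}\tfrac{e_j^{(2v)}}{2}\tilde y_{v-j}(k)$. Put $$\rho_v=1-2\sum_{j=1}^{v}e_j^{(2v)}y_{v-j}(-1),\qquad \tilde\rho_v=2v-\sum_{j=1}^{v}e_j^{(2v)}\tilde y_{v-j}'(-1),$$ where $'$ denotes the derivative in $k$. Then $\rho_v$ is an odd integer, $\tilde\rho_v$ is an even integer (both independent of $n$), and $$\sum_{k=0}^{n-1}(2k+1)^{2v+1}D_k\equiv \rho_v n\pmod{n^3},\qquad \sum_{k=0}^{n-1}(-1)^k(2k+1)^{2v+1}D_k\equiv \tilde\rho_v n^2\pmod{n^3}.$$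
   Context: $D_n=\sum_{k=0}^{n}\binom{n}{k}\binom{n+k}{k}$ are the central Delannoy numbers. For $s\in\mathbb{N}$ and $1\le j\le\lfloor (s+1)/2\rfloor$, $e_j^{(s)}=\binom{s}{2j}2^{2j-1}+\binom{s}{2j-1}2^{2j-2}$ (these are even integers when $s$ is even). *)

(* Defs.v *)
From mathcomp Require Import all_boot all_order all_algebra.
Set Implicit Arguments. Unset Strict Implicit. Unset Printing Implicit Defensive.
Import Order.TTheory GRing.Theory Num.Theory.
Local Open Scope ring_scope.

Definition delannoy (n : nat) : nat :=
  (\sum_(k < n.+1) 'C(n, k) * 'C(n + k, k))%N.

(* e_j^{(s)} = C(s,2j) 2^{2j-1} + C(s,2j-1) 2^{2j-2}, used for j >= 1 *)
Definition ecoef (j s : nat) : nat :=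
  ('C(s, 2 * j) * 2 ^ (2 * j - 1) + 'C(s, (2 * j).-1) * 2 ^ (2 * j - 2))%N.

Definition lin23 : {poly rat} := 'X *+ 2 + 3%:P.

(* yseq v = [:: y_0; ...; y_v] *)
Fixpoint yseq (v : nat) : seq {poly rat} :=
  if v is v'.+1 then
    let s := yseq v' in
    rcons s ((- 2^-1) *: lin23 ^+ (2 * v)
             + \sum_(1 <= j < v.+1) (ecoef j (2 * v))%:R *: nth 0 s (v - j))
  else [:: (- 2^-1)%:P].

Definition y (v : nat) : {poly rat} := nth 0 (yseq v) v.

(* ytseq v = [:: ~y_0; ...; ~y_v] *)
Fixpoint ytseq (v : nat) : seq {poly rat} :=
  if v is v'.+1 then
    let s := ytseq v' in
    rcons s ((4^-1) *: lin23 ^+ (2 * v)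
             - \sum_(1 <= j < v.+1) ((ecoef j (2 * v))%:R / 2) *: nth 0 s (v - j))
  else [:: (4^-1)%:P].

Definition yt (v : nat) : {poly rat} := nth 0 (ytseq v) v.

Definition rho (v : nat) : rat :=
  1 - 2 * \sum_(1 <= j < v.+1) (ecoef j (2 * v))%:R * (y (v - j)).[-1].

Definition rhot (v : nat) : rat :=
  (2 * v)%:R - \sum_(1 <= j < v.+1) (ecoef j (2 * v))%:R * ((yt (v - j))^`()).[-1].

(* Main.v *)
Require Import Defs.
From mathcomp Require Import all_boot all_order all_algebra.
From mathcomp Require Import ring zify.
Set Implicit Arguments. Unset Strict Implicit. Unset Printing Implicit Defensive.
Import Order.TTheory GRing.Theory Num.Theory.
Local Open Scope ring_scope.

(* Let p_k = \sum_j C(k,j) C(k+j,j) x^j = P_k(1 + 2x), P_k the Legendre polynomial.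
   Then D_k is p_k at x = 1, and (-1)^k D_k is p_k at x = -2. The operator adjoint to
   the three-term recurrence of p_k maps -2 y_v (for x = 1), resp. 4 ~y_v (for x =
   -2), to -2x (2k+1)^(2v+1), so summation by parts evaluates both sums in closed
   form in terms of D_n, D_{n-1} and the values of these polynomials at n-1 and n-2.
   They are integer polynomials P in (2k+3)^2, and a Taylor expansion of P at 1
   reduces the theorem to D_n = 1 mod n^2 and D_n + D_{n-1} = 0 mod 4n^2 for n = 2^a,
   with rho_v = P(1) and ~rho_v = 2P'(1).

   For the two congruences, expand at x = -2 and subtract \sum_k C(n,k) (-2)^k = (1-2)^n
   = 1. This writes D_n - 1, resp. (D_n + D_{n-1})/2, as the sum over k >= 1 of
   (-2)^k C(n,k) (C(n+l,l) - 1), where l = k, resp. l = k-1, and C(n+l,l) - 1 =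
   \sum_{1<=i<=l} C(n+i-1,i). The 2-adic valuations of C(n,k) and C(n+i-1,i) are at
   least a - v(k) and a - v(i), and v(i) + v(k) <= k, with strict inequality when i <
   k. *)

(** * Coefficients of the Legendre polynomials and the three-term recurrence *)

Definition dcoef (n k : nat) : nat := 'C(n, k) * 'C(n + k, k).

Lemma dcoef_small (n k : nat) : (n < k)%N -> dcoef n k = 0%N.
Proof. by move=> ltnk; rewrite /dcoef bin_small. Qed.

Lemma dcoefSS (n k : nat) :
  (k.+1 ^ 2 * dcoef n.+1 k.+1 = (n + k.+2) * (n + k.+1) * dcoef n k)%N.
Proof.
have h1 := mul_bin_diag n.+1 k; have h2 := mul_bin_diag (n + k.+2) k.
have h3 := mul_bin_down (n + k.+1) k.
rewrite /= !addnS /= in h1 h2 h3.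
rewrite (_ : (n + k).+1 - k = n.+1)%N in h3; last by lia.
rewrite /dcoef addSn !addnS expnS expn1.
transitivity ((k.+1 * 'C(n.+1, k.+1)) * (k.+1 * 'C((n + k).+2, k.+1)))%N; first by ring.
rewrite -h1 -h2 -[RHS]mulnA (_ : _ * ((n+k).+2 * _) = (n + k).+2 * ('C(n, k) * (n.+1 * 'C((n + k).+1, k))))%N; last by ring.
by rewrite -h3; ring.
Qed.

Lemma bin_left_int (n k : nat) :
  k.+1%:Z * 'C(n, k.+1)%:Z = (n%:Z - k%:Z) * 'C(n, k)%:Z.
Proof.
case: (leqP k n) => [lekn | ltnk]; last by rewrite !bin_small; lia.
by rewrite subzn // -!PoszM mul_bin_left.
Qed.

Lemma dcoefS (n k : nat) :
  k.+1%:Z ^+ 2 * (dcoef n k.+1)%:Z = (n%:Z - k%:Z) * (n + k.+1)%:Z * (dcoef n k)%:Z.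
Proof.
have h2 := mul_bin_diag (n + k.+1) k; rewrite addnS /= in h2.
rewrite /dcoef !addnS !PoszM.
transitivity ((k.+1%:Z * 'C(n, k.+1)%:Z) * (k.+1 * 'C((n + k).+1, k.+1))%N%:Z).
  by rewrite PoszM; ring.
by rewrite bin_left_int -h2 PoszM; ring.
Qed.

Lemma dcoef_down (n k : nat) :
  (n + k.+1)%:Z * (dcoef n k)%:Z = (n.+1%:Z - k%:Z) * (dcoef n.+1 k)%:Z.
Proof.
case: (leqP k n.+1) => [lekn | ltnk]; last by rewrite !dcoef_small //; lia.
rewrite subzn // -!PoszM; congr Posz.
have h1 := mul_bin_down n.+1 k; have h2 := mul_bin_down (n + k.+1) k.
rewrite /= in h1; rewrite addnS /= (_ : (n + k).+1 - k = n.+1)%N in h2; last by lia.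
rewrite /dcoef addSn addnS mulnCA h2 mulnCA.
by rewrite !mulnA -h1; ring.
Qed.

(** The three-term recurrence, read off on the coefficient of [x ^+ k.+1]. After multiplication by
    [k.+1 ^ 2] every term is a polynomial multiple of [dcoef n k], and a polynomial identity in [n]
    and [k] remains. At [n = 0] the truncated [n.-1] is harmless because of its factor [n]. *)
Lemma dcoef_rec (n k : nat) :
  n.+1%:Z * (dcoef n.+1 k.+1)%:Z =
  (2 * n%:Z + 1) * ((dcoef n k.+1)%:Z + 2 * (dcoef n k)%:Z) - n%:Z * (dcoef n.-1 k.+1)%:Z.
Proof.
apply: (@mulfI _ (k.+1%:Z ^+ 2)) => //.
have h1 : k.+1%:Z ^+ 2 * (dcoef n.+1 k.+1)%:Z = (n + k.+2)%:Z * (n + k.+1)%:Z * (dcoef n k)%:Z.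
  by rewrite -!PoszM -dcoefSS.
have h2 := dcoefS n k.
have h3 : n%:Z * (k.+1%:Z ^+ 2 * (dcoef n.-1 k.+1)%:Z) =
          n%:Z * ((n%:Z - 1 - k%:Z) * (n%:Z - k%:Z) * (dcoef n k)%:Z).
  case: n {h1 h2} => [|n]; first by rewrite !mul0r.
  congr (_ * _); rewrite dcoefS -mulrA dcoef_down mulrA.
  by congr (_ * _ * _); lia.
transitivity ((2 * n%:Z + 1) * (k.+1%:Z ^+ 2 * (dcoef n k.+1)%:Z)
    + 2 * (2 * n%:Z + 1) * k.+1%:Z ^+ 2 * (dcoef n k)%:Z
    - n%:Z * (k.+1%:Z ^+ 2 * (dcoef n.-1 k.+1)%:Z)); last by ring.
rewrite mulrCA h1 h2 h3.
have -> : (n + k.+2)%:Z = n%:Z + k%:Z + 2 by lia.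
have -> : (n + k.+1)%:Z = n%:Z + k%:Z + 1 by lia.
rewrite -[n.+1]addn1 -[k.+1]addn1 !PoszD.
by ring.
Qed.

(* The Legendre polynomial [P_n (1 + 2 * x)]. *)
Definition dpoly (x : int) (n : nat) : int :=
  \sum_(k < n.+1) x ^+ k * (dcoef n k)%:Z.

Lemma dpolyE (x : int) (n N : nat) : (n < N)%N ->
  dpoly x n = \sum_(k < N) x ^+ k * (dcoef n k)%:Z.
Proof.
move=> ltnN; rewrite /dpoly (big_ord_widen _ (fun k => x ^+ k * (dcoef n k)%:Z) ltnN).
rewrite big_mkcond /=; apply: eq_bigr => k _.
by case: ltnP => // ltnk; rewrite dcoef_small // mulr0.
Qed.

Lemma dpolyE_recl (x : int) (n N : nat) : (n <= N)%N ->
  dpoly x n = 1 + \sum_(k < N) x ^+ k.+1 * (dcoef n k.+1)%:Z.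
Proof.
by move=> lenN; rewrite (@dpolyE x n N.+1) // big_ord_recl /dcoef !bin0.
Qed.

Lemma dpoly_rec (x : int) (n : nat) :
  n.+1%:Z * dpoly x n.+1 =
  (2 * n%:Z + 1) * (1 + 2 * x) * dpoly x n - n%:Z * dpoly x n.-1.
Proof.
have -> : (2 * n%:Z + 1) * (1 + 2 * x) * dpoly x n =
   (2 * n%:Z + 1) * (dpoly x n + 2 * (x * dpoly x n)) by ring.
have -> : x * dpoly x n = \sum_(k < n.+1) x ^+ k.+1 * (dcoef n k)%:Z.
  by rewrite mulr_sumr; apply: eq_bigr => k _; rewrite exprS mulrA.
rewrite (@dpolyE_recl x n.+1 n.+1) // (@dpolyE_recl x n n.+1) //.
rewrite (@dpolyE_recl x n.-1 n.+1); last by lia.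
set S := \sum_(_ < _) _; set A := \sum_(_ < _) _; set B := \sum_(_ < _) _; set C := \sum_(_ < _) _.
have : n.+1%:Z * S = (2 * n%:Z + 1) * (A + 2 * B) - n%:Z * C.
  rewrite /S /A /B /C !mulr_sumr -big_split /= mulr_sumr -sumrB; apply: eq_bigr => k _.
  by rewrite mulrCA dcoef_rec; ring.
by rewrite -[n.+1]addn1 PoszD => h; rewrite mulrDr h; ring.
Qed.

Lemma delannoyE (n : nat) : (delannoy n)%:Z = dpoly 1 n.
Proof.
rewrite /delannoy /dpoly -natz raddf_sum /=.
by apply: eq_bigr => k _; rewrite expr1n mul1r natz.
Qed.

(* The symmetry [P_n (- x) = (-1)^n P_n x] of the Legendre polynomials at [x = 3]. *)
Lemma delannoy_sign (n : nat) : (delannoy n)%:Z = (-1) ^+ n * dpoly (-2) n.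
Proof.
rewrite delannoyE.
suff [] : dpoly 1 n = (-1) ^+ n * dpoly (-2) n /\
          dpoly 1 n.+1 = (-1) ^+ n.+1 * dpoly (-2) n.+1 by [].
elim: n => [|n [IH0 IH1]].
  by rewrite /dpoly !big_ord_recl !big_ord0.
split=> //; apply: (@mulfI _ n.+2%:Z) => //.
rewrite mulrCA !dpoly_rec /= IH0 IH1 !exprS; ring.
Qed.

(** * 2-adic valuations of binomial coefficients *)

(** The odd part of [i] is coprime to [2 ^ a] and can be cancelled. The conclusion is the valuation
    bound v(x) >= a - v(i), written without subtraction. *)
Lemma pow2_dvd_logn (a i x z : nat) : (0 < i)%N -> (i * x = 2 ^ a * z)%N ->
  (2 ^ a %| x * 2 ^ logn 2 i)%N.
Proof.
move=> i_gt0 e.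
have [m odd_m def_i] := pfactor_coprime (isT : prime 2) i_gt0.
rewrite -(@Gauss_dvdr _ m); last by rewrite coprimeXl.
by rewrite mulnCA -def_i mulnC e dvdn_mulr.
Qed.

Lemma pow2_dvd_bin (a k : nat) : (0 < k)%N -> (2 ^ a %| 'C(2 ^ a, k) * 2 ^ logn 2 k)%N.
Proof.
case: k => // k _; apply: (@pow2_dvd_logn _ _ _ 'C((2 ^ a).-1, k)) => //.
by rewrite mul_bin_diag.
Qed.

Lemma pow2_dvd_bin_up (a m i : nat) : (2 ^ a = m.+1)%N ->
  (2 ^ a %| 'C(m + i.+1, i.+1) * 2 ^ logn 2 i.+1)%N.
Proof.
move=> em; apply: (@pow2_dvd_logn _ _ _ 'C(m + i.+1, i)) => //.
by rewrite mul_bin_left em; congr (_ * _)%N; lia.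
Qed.

(** Since 2^v(i) <= i <= j-1 and 2^v(j) <= j, it is enough that (j-1)j < 2^j. *)
Lemma leq_logn2D (i j : nat) : (0 < i < j)%N -> (logn 2 i + logn 2 j < j)%N.
Proof.
move=> /andP[i_gt0 ltij].
rewrite -(@ltn_exp2l 2) // expnD.
have hi : (2 ^ logn 2 i <= i)%N by apply: dvdn_leq => //; apply: pfactor_dvdnn.
have hj : (2 ^ logn 2 j <= j)%N by apply: dvdn_leq; [lia | apply: pfactor_dvdnn].
apply: (@leq_ltn_trans (j.-1 * j)); first by apply: leq_mul => //; lia.
case: j {ltij hj} => // j /=; elim: j => // -[|[|j]] // IH.
rewrite expnS; nia.
Qed.

Lemma leq_logn2_double (k : nat) : (0 < k)%N -> (logn 2 k + logn 2 k <= k)%N.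
Proof.
move=> k_gt0.
have : (2 ^ logn 2 k <= k)%N by apply: dvdn_leq => //; apply: pfactor_dvdnn.
apply: leq_trans; elim: (logn 2 k) => // -[|v] // IH.
rewrite expnS; lia.
Qed.

(** Each binomial coefficient supplies [2 ^ a] up to its deficit, v(k) or v(i+1); the factor [2 ^ k]
    pays for both deficits and for the surplus [2 ^ e]. *)
Lemma pow2_dvd_term (a m e i k : nat) : (2 ^ a = m.+1)%N -> (0 < k)%N ->
  (logn 2 i.+1 + logn 2 k + e <= k)%N ->
  (2 ^ (2 * a + e) %| 2 ^ k * 'C(m.+1, k) * 'C(m + i.+1, i.+1))%N.
Proof.
move=> em k_gt0 hv.
have -> : (2 ^ k = 2 ^ logn 2 i.+1 * 2 ^ logn 2 k * 2 ^ e *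
    2 ^ (k - (logn 2 i.+1 + logn 2 k + e)))%N by rewrite -!expnD; congr expn; lia.
have -> : (2 ^ (2 * a + e) = 2 ^ a * 2 ^ a * 2 ^ e)%N by rewrite -!expnD; congr expn; lia.
rewrite -em [X in (_ %| X)%N](_ : _ = (('C(2 ^ a, k) * 2 ^ logn 2 k) *
  ('C(m + i.+1, i.+1) * 2 ^ logn 2 i.+1)) * 2 ^ e *
  2 ^ (k - (logn 2 i.+1 + logn 2 k + e)))%N; last by ring.
apply: dvdn_mulr; apply: dvdn_mul => //; apply: dvdn_mul.
  exact: pow2_dvd_bin.
exact: pow2_dvd_bin_up.
Qed.

(** * Delannoy numbers at powers of two, modulo n^2 and 4n^2 *)

Lemma bin_up_sum (m k : nat) :
  ('C(m.+1 + k, k) = 1 + \sum_(i < k) 'C(m + i.+1, i.+1))%N.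
Proof.
elim: k => [|k IH]; first by rewrite big_ord0 bin0.
by rewrite big_ord_recr /= addnA -IH addnS binS addSn -addnS addnC.
Qed.

Lemma sum_bin_sign (m : nat) : odd m ->
  \sum_(k < m.+2) (-2) ^+ k * 'C(m.+1, k)%:Z = 1.
Proof.
move=> odd_m; transitivity ((1 + -2 : int) ^+ m.+1); last first.
  by rewrite (_ : 1 + -2 = -1) // -signr_odd /= odd_m.
by rewrite exprDn; apply: eq_bigr => k _; rewrite expr1n mul1r -(mulr_natr _ 'C(_, _)) !natz.
Qed.

(** Pascal's rule, applied to each factor in turn, leaves two products; they are equal by [e], hence
    the factor 2. *)
Lemma dcoef_diff (m k : nat) :
  (dcoef m.+1 k.+1 = dcoef m k.+1 + 2 * ('C(m.+1, k.+1) * 'C(m.+1 + k, k)))%N.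
Proof.
have e : (k.+1 * ('C(m, k) * 'C(m.+1 + k, k.+1)) = k.+1 * ('C(m.+1, k.+1) * 'C(m.+1 + k, k)))%N.
  rewrite mulnCA mul_bin_left [RHS]mulnA -mul_bin_diag (_ : m.+1 + k - k = m.+1)%N; last by lia.
  by rewrite mulnCA mulnA.
have {}e : ('C(m, k) * 'C(m.+1 + k, k.+1) = 'C(m.+1, k.+1) * 'C(m.+1 + k, k))%N.
  by apply/eqP; rewrite -(eqn_pmul2l (ltn0Sn k)) e.
rewrite -e /dcoef addnS (binS (m.+1 + k)) mulnDr -e (binS m k) -addSnnS.
ring.
Qed.

Lemma pow2_dvdz_bin_up_sum (a m e k l : nat) : (2 ^ a = m.+1)%N ->
  (l <= k)%N -> (forall i, (0 < i <= l)%N -> (logn 2 i + logn 2 k + e <= k)%N) ->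
  ((2 ^ (2 * a + e))%N%:Z %|
     (-2) ^+ k * 'C(m.+1, k)%:Z * ('C(m.+1 + l, l)%:Z - 1))%Z.
Proof.
move=> em lelk hv; case: k lelk hv => [|k] lelk hv.
  by case: l lelk {hv} => // _; rewrite bin0 subrr mulr0 dvdz0.
rewrite bin_up_sum PoszD addrAC subrr add0r exprNn -!mulrA dvdz_mull //.
rewrite -natrX natz -!PoszM mulnA big_distrr /= dvdzE !absz_nat dvdn_sum // => i _.
by apply: (@pow2_dvd_term _ _ _ i k.+1 em) => //; apply: hv; rewrite /= ltn_ord.
Qed.

Lemma odd_pred_pow2 (a m : nat) : (0 < a)%N -> (2 ^ a = m.+1)%N -> odd m.
Proof. by case: a => // a _ em; rewrite -[odd m]negbK -/(odd m.+1) -em oddX. Qed.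

Lemma delannoy_mod (a m : nat) : (0 < a)%N -> (2 ^ a = m.+1)%N ->
  ((2 ^ (2 * a))%N%:Z %| (delannoy m.+1)%:Z - 1)%Z.
Proof.
move=> a_gt0 em; have odd_m := odd_pred_pow2 a_gt0 em.
rewrite delannoy_sign -signr_odd /= odd_m expr0 mul1r -[X in _ - X](@sum_bin_sign m) //.
rewrite /dpoly -sumrB rpred_sum // => k _.
rewrite /dcoef PoszM mulrA -[X in _ - X]mulr1 -mulrBr -[(2 * a)%N]addn0.
apply: pow2_dvdz_bin_up_sum => // i; rewrite addn0 (leq_eqVlt i) => /andP[i_gt0 /predU1P[eik|ltik]].
  by rewrite -eik leq_logn2_double.
by rewrite ltnW // leq_logn2D // i_gt0.
Qed.

Lemma delannoyD_mod (a m : nat) : (0 < a)%N -> (2 ^ a = m.+1)%N ->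
  ((2 ^ (2 * a + 2))%N%:Z %| (delannoy m.+1)%:Z + (delannoy m)%:Z)%Z.
Proof.
move=> a_gt0 em; have odd_m := odd_pred_pow2 a_gt0 em.
rewrite !delannoy_sign -!(signr_odd _ m) -signr_odd /= odd_m expr0 mul1r expr1 mulN1r.
rewrite (@dpolyE_recl _ m.+1 m.+1) // (@dpolyE_recl _ m m.+1) //.
set A := \sum_(_ < _) _; set B := \sum_(_ < _) _.
have -> : 1 + A - (1 + B) = A - B by ring.
rewrite -sumrB.
have sum0 : \sum_(k < m.+1) (-2) ^+ k.+1 * 'C(m.+1, k.+1)%:Z = 0.
  by apply: (addrI 1); rewrite addr0 -[RHS](sum_bin_sign odd_m) [in RHS]big_ord_recl bin0.
(* Subtracting twice the vanishing sum turns C(n+k,k) into C(n+k,k) - 1 in every term. *)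
rewrite -[X in (_ %| X)%Z]subr0 -[X in _ - X](mulr0 2) -[X in _ * X]sum0 mulr_sumr -sumrB.
rewrite rpred_sum // => k _.
rewrite dcoef_diff PoszD (PoszM 2) PoszM.
rewrite [X in X \in _](_ : _ =
  2 * ((-2) ^+ k.+1 * 'C(m.+1, k.+1)%:Z * ('C(m.+1 + k, k)%:Z - 1))); last by ring.
(* One of the two extra factors 2 comes from [dcoef_diff]; the other is the surplus e = 1, available
   because now i <= k < k+1. *)
rewrite addn2 expnS PoszM -(addn1 (2 * a)); apply: dvdz_mul => //.
apply: pow2_dvdz_bin_up_sum => // i /andP[i_gt0 leik].
by rewrite addn1 leq_logn2D // i_gt0.
Qed.

(** * The polynomial families and the adjoint recurrence *)

(* Satisfied by [-2 *: y v] with [c = 1] and by [4 *: yt v] with [c = - 2^-1]; for [v = 0] it says [z 0 = 1]. *)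
Definition delannoy_family (c : rat) (z : nat -> {poly rat}) : Prop :=
  forall v, z v = lin23 ^+ (2 * v)
                  + c *: \sum_(1 <= j < v.+1) (ecoef j (2 * v))%:R *: z (v - j)%N.

Lemma horner_lin23 (x : rat) : lin23.[x] = 2 * x + 3.
Proof. by rewrite /lin23 hornerD hornerMn hornerX hornerC -mulr_natl. Qed.

Lemma size_yseq (v : nat) : size (yseq v) = v.+1.
Proof. by elim: v => //= v IH; rewrite size_rcons IH. Qed.

Lemma nth_yseq (v i : nat) : (i <= v)%N -> nth 0 (yseq v) i = y i.
Proof.
elim: v => [|v IH]; first by rewrite leqn0 => /eqP ->.
rewrite leq_eqVlt => /predU1P[-> //|leiv].
by rewrite /= nth_rcons size_yseq leiv IH.
Qed.

Lemma size_ytseq (v : nat) : size (ytseq v) = v.+1.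
Proof. by elim: v => //= v IH; rewrite size_rcons IH. Qed.

Lemma nth_ytseq (v i : nat) : (i <= v)%N -> nth 0 (ytseq v) i = yt i.
Proof.
elim: v => [|v IH]; first by rewrite leqn0 => /eqP ->.
rewrite leq_eqVlt => /predU1P[-> //|leiv].
by rewrite /= nth_rcons size_ytseq leiv IH.
Qed.

Lemma delannoy_family_y : delannoy_family 1 (fun v => (-2) *: y v).
Proof.
case=> [|v]; first by rewrite big_geq // scaler0 addr0 /y /= -mul_polyC -polyCM.
rewrite {1}/y [yseq v.+1]/= nth_rcons size_yseq ltnn eqxx scalerDr scalerA mulrN mulNr opprK divff // !scale1r.
congr (_ + _); rewrite scaler_sumr; apply: eq_big_nat => j /andP[j_gt0 lejv].
rewrite nth_yseq; last by lia.
by rewrite !scalerA mulrC.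
Qed.

Lemma delannoy_family_yt : delannoy_family (- 2^-1) (fun v => 4 *: yt v).
Proof.
case=> [|v]; first by rewrite big_geq // scaler0 addr0 /yt /= -mul_polyC -polyCM.
rewrite {1}/yt [ytseq v.+1]/= nth_rcons size_ytseq ltnn eqxx scalerDr scalerA divff // scale1r.
congr (_ + _); rewrite scalerN scaleNr !scaler_sumr; congr (- _).
apply: eq_big_nat => j /andP[j_gt0 lejv].
rewrite nth_ytseq; last by lia.
by rewrite !scalerA; congr (_ *: _); ring.
Qed.

(** Pairs the indices 2j-1 and 2j, the two binomial terms that make up [ecoef j]. *)
Lemma sum_ord_pairs (R : nmodType) (f : nat -> R) (v : nat) :
  \sum_(i < (2 * v).+1) f i = f 0%N + \sum_(1 <= j < v.+1) (f (2 * j).-1 + f (2 * j)%N).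
Proof.
elim: v => [|v IH]; first by rewrite big_ord1 big_geq // addr0.
rewrite mulnS !addSn add0n 2!big_ord_recr /= IH [in RHS]big_nat_recr // -!addrA.
by rewrite mulnS !addSn add0n.
Qed.

(** The origin of the numbers e_j: in the binomial expansion the even indices survive through the
    factor u and the odd ones through -1 and +1, so indices 2j and 2j-1 both contribute to
    u^(2(v-j)+1). *)
Lemma ecoef_binomial (R : comRingType) (u : R) (v : nat) :
  (u - 1) * (u - 2) ^+ (2 * v) + (u + 1) * (u + 2) ^+ (2 * v) =
  2 * u ^+ (2 * v).+1 +
  4 * \sum_(1 <= j < v.+1) (ecoef j (2 * v))%:R * u ^+ (2 * (v - j)).+1.
Proof.
rewrite !exprDn !mulr_sumr -big_split /=.
rewrite (sum_ord_pairs (fun i => (u - 1) * (u ^+ (2 * v - i) * (-2) ^+ i *+ 'C(2 * v, i)) +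
   (u + 1) * (u ^+ (2 * v - i) * 2 ^+ i *+ 'C(2 * v, i)))).
congr (_ + _); first by rewrite subn0 !bin0 !expr0 exprS; ring.
apply: eq_big_nat => -[//|j] /andP[_ lejv].
rewrite /ecoef (_ : (2 * j.+1).-1 = (2 * j).+1)%N; last by lia.
rewrite (_ : 2 * j.+1 - 1 = (2 * j).+1)%N; last by lia.
rewrite (_ : 2 * j.+1 - 2 = 2 * j)%N; last by lia.
rewrite (_ : 2 * j.+1 = (2 * j).+2)%N; last by lia.
rewrite (_ : 2 * v - (2 * j).+1 = (2 * (v - j.+1)).+1)%N; last by lia.
rewrite (_ : 2 * v - (2 * j).+2 = 2 * (v - j.+1))%N; last by lia.
rewrite !natrD !natrM !natrX !exprS !exprM sqrrN.
by ring.
Qed.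

(* The left-hand side is the adjoint of the recurrence [dpoly_rec]. *)
Lemma delannoy_family_adjoint (x : rat) (z : nat -> {poly rat}) : x != 0 ->
  delannoy_family x^-1 z -> forall v k,
  k * (z v).[k - 2] - (1 + 2 * x) * (2 * k + 1) * (z v).[k - 1] + (k + 1) * (z v).[k]
    = - (2 * x) * (2 * k + 1) ^+ (2 * v).+1.
Proof.
move=> x_neq0 hz; elim/ltn_ind => v IH k.
have ev (t : rat) : (z v).[t] = (2 * t + 3) ^+ (2 * v) +
    x^-1 * \sum_(1 <= j < v.+1) (ecoef j (2 * v))%:R * (z (v - j)%N).[t].
  rewrite hz hornerD hornerZ horner_sum horner_exp; congr (_ ^+ _ + _ * _).
    exact: horner_lin23.
  by apply: eq_bigr => j _; rewrite hornerZ.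
rewrite !ev.
set A := \sum_(_ <= _ < _) _; set B := \sum_(_ <= _ < _) _; set C := \sum_(_ <= _ < _) _.
have h : k * A - (1 + 2 * x) * (2 * k + 1) * B + (k + 1) * C = 
  - (2 * x) * \sum_(1 <= j < v.+1) (ecoef j (2 * v))%:R * (2 * k + 1) ^+ (2 * (v - j)).+1.
  rewrite /A /B /C !mulr_sumr -sumrB -big_split /=; apply: eq_big_nat => j /andP[j_gt0 lejv].
  by rewrite [RHS]mulrCA -IH; [ring | lia].
have := ecoef_binomial (2 * k + 1) v; move: h; set S := \sum_(_ <= _ < _) _ => h hb.
rewrite (_ : 2 * (k - 2) + 3 = 2 * k + 1 - 2); last by ring.
rewrite (_ : 2 * (k - 1) + 3 = 2 * k + 1); last by ring.
rewrite (_ : 2 * k + 3 = 2 * k + 1 + 2); last by ring.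
move: hb h; set u := 2 * k + 1; set p := (u - 2) ^+ _; set q := (u + 2) ^+ _ => hb h.
(* The operator applied to [lin23 ^+ (2 * v)] gives -2x u^(2v+1) plus twice the sum [S]; by
   induction the tail contributes -2 [S], which cancels it. *)
transitivity (2^-1 * ((u - 1) * p + (u + 1) * q) - (1 + 2 * x) * u ^+ (2 * v).+1 +
  x^-1 * (k * A - (1 + 2 * x) * u * B + (k + 1) * C)).
  by rewrite exprS /u; field.
by rewrite hb h; field.
Qed.

(** * Taylor expansion and integrality *)

(** The remainder [r] stays in [R], so over the integers the error is a true multiple of h^2. *)
Lemma horner_taylor1 (R : comRingType) (P : {poly R}) (x : R) : 
  forall h, exists r, P.[x + h] = P.[x] + h * P^`().[x] + h ^+ 2 * r.
Proof.
move=> h; elim/poly_ind: P => [|P c [r IH]].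
  by exists 0; rewrite deriv0 !horner0; ring.
exists (r * (x + h) + P^`().[x]).
rewrite derivD derivM derivX derivC !hornerE IH; ring.
Qed.

Lemma ecoef_even (j v : nat) : (0 < j)%N -> ~~ odd (ecoef j (2 * v)).
Proof.
case: j => [//|[|j]] _; rewrite /ecoef oddD !oddM oddX; first by rewrite bin1 oddM andbF.
by rewrite oddX (_ : 2 * j.+2 - 2 = (2 * j).+2)%N ?andbF //; lia.
Qed.

Local Notation intpoly P := (map_poly (intr : int -> rat) P).

(** The evenness of e_j absorbs the denominator 2 of the constant. Keeping the factor [m] on [G]
    gives the value at 1 modulo [m], which yields the parity of rho_v when [m = 2]. *)
Lemma delannoy_family_int (m : int) (z : nat -> {poly rat}) :
  delannoy_family (m%:~R / 2) z ->
  forall v, exists G : {poly int}, z v = intpoly ('X^v + m *: G) \Po (lin23 ^+ 2).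
Proof.
move=> hz; elim/ltn_ind => v IH.
have [G hG] : exists G : {poly int},
    \sum_(1 <= j < v.+1) (ecoef j (2 * v))./2%:R *: z (v - j)%N = intpoly G \Po (lin23 ^+ 2).
  rewrite big_nat; apply: (big_ind (fun p => exists G : {poly int}, p = intpoly G \Po (lin23 ^+ 2)))
      => [|p q [P ->] [Q ->]|j /andP[j_gt0 lejv]].
  - by exists 0; rewrite rmorph0 comp_poly0.
  - by exists (P + Q); rewrite rmorphD comp_polyD.
  have [|G ->] := IH (v - j)%N; first by lia.
  exists ((ecoef j (2 * v))./2%:Z *: ('X^(v - j) + m *: G)).
  by rewrite [in RHS]map_polyZ comp_polyZ /=.
exists G; rewrite hz rmorphD /= map_polyXn map_polyZ /= comp_polyD comp_polyZ -hG.
rewrite comp_Xn_poly -exprM !scaler_sumr; congr (_ + _).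
apply: eq_big_nat => j /andP[j_gt0 _]; rewrite !scalerA; congr (_ *: _).
have /even_halfK {1}<- := @ecoef_even j v j_gt0.
by rewrite -muln2 natrM; field.
Qed.

Lemma horner_intpoly (P : {poly int}) (t : int) (x : rat) : 2 * x + 3 = t%:~R ->
  (intpoly P \Po (lin23 ^+ 2)).[x] = (P.[t ^+ 2])%:~R.
Proof.
move=> e.
rewrite horner_comp horner_exp (_ : lin23.[x] = t%:~R).
  by rewrite -rmorphXn /= horner_map.
by rewrite horner_lin23.
Qed.

Lemma deriv_intpoly (P : {poly int}) :
  (intpoly P \Po (lin23 ^+ 2))^`().[-1] = 4 * (P^`().[1])%:~R.
Proof.
rewrite deriv_comp hornerM deriv_map (@horner_intpoly _ 1); last by ring.
rewrite expr1n deriv_exp hornerMn hornerM horner_exp horner_lin23 /lin23 derivD derivMn derivX derivC.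
by rewrite !hornerE; ring.
Qed.

(** * Summation by parts and the two congruences *)

(** Induction on [n]: replacing the new summand by the adjoint identity and using [dpoly_rec] makes
    the sum telescope. The arguments (2n+1)^2 and (2n-1)^2 of [P] correspond to k = n-1 and k =
    n-2. *)
Lemma sum_delannoy_family (x : int) (z : nat -> {poly rat}) (v : nat) (P : {poly int}) :
  x != 0 -> delannoy_family (x%:~R)^-1 z -> z v = intpoly P \Po (lin23 ^+ 2) ->
  forall n : nat, - (2 * x) * \sum_(k < n) ((2 * k + 1) ^ (2 * v + 1))%N%:Z * dpoly x k =
    n%:Z * (dpoly x n.-1 * P.[(2 * n%:Z + 1) ^+ 2] - dpoly x n * P.[(2 * n%:Z - 1) ^+ 2]).
Proof.
move=> x_neq0 hz hP.
have adj (k : int) : k * P.[(2 * k - 1) ^+ 2] - (1 + 2 * x) * (2 * k + 1) * P.[(2 * k + 1) ^+ 2]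
    + (k + 1) * P.[(2 * k + 3) ^+ 2] = - (2 * x) * (2 * k + 1) ^+ (2 * v + 1).
  apply: (@intr_inj rat); rewrite addn1.
  have := @delannoy_family_adjoint x%:~R z _ hz v k%:~R.
  rewrite intr_eq0 hP => /(_ x_neq0).
  rewrite (@horner_intpoly _ (2 * k - 1)); last by ring.
  rewrite (@horner_intpoly _ (2 * k + 1)); last by ring.
  rewrite (@horner_intpoly _ (2 * k + 3)); last by ring.
  move=> h; transitivity (- (2 * x%:~R) * (2 * k%:~R + 1) ^+ (2 * v).+1 : rat).
    by rewrite -h; move: P.[_] P.[_] P.[_] => p q r; ring.
  by move: (2 * v).+1 => w; rewrite rmorphM rmorphXn /=; congr (_ * _ ^+ _); ring.
elim=> [|n IH]; first by rewrite big_ord0 mulr0 mul0r.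
rewrite big_ord_recr mulrDr IH /=.
have -> : ((2 * n + 1) ^ (2 * v + 1))%N%:Z = (2 * n%:Z + 1) ^+ (2 * v + 1).
  by rewrite -[LHS]natz natrX natrD natrM !natz.
rewrite mulrA -adj [RHS]mulrBr [X in _ = _ - X]mulrA dpoly_rec.
rewrite -[n.+1]addn1 PoszD.
rewrite (_ : 2 * (n%:Z + 1%:Z) + 1 = 2 * n%:Z + 3); last by ring.
rewrite (_ : 2 * (n%:Z + 1%:Z) - 1 = 2 * n%:Z + 1); last by ring.
ring.
Qed.

(** The defining recursion evaluated at -1, where [lin23] equals 1. *)
Lemma rhoE (v : nat) : rho v = ((-2) *: y v).[-1].
Proof.
rewrite delannoy_family_y hornerD scale1r horner_exp horner_sum /rho; congr (_ + _).
  by rewrite horner_lin23 (_ : 2 * -1 + 3 = 1) ?expr1n //; ring.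
rewrite mulr_sumr -sumrN; apply: eq_bigr => j _; rewrite !hornerZ; ring.
Qed.

Lemma rhotE (v : nat) : rhot v = 2 * (yt v)^`().[-1].
Proof.
have -> : yt v = 4^-1 *: (4 *: yt v) by rewrite scalerA mulVf // scale1r.
rewrite delannoy_family_yt derivZ hornerZ derivD derivZ hornerD hornerZ raddf_sum horner_sum /rhot.
rewrite deriv_exp hornerMn hornerM horner_exp horner_lin23 (_ : 2 * -1 + 3 = 1) // expr1n mulr1.
rewrite /lin23 derivD derivMn derivX derivC hornerD hornerMn !hornerE.
under [in RHS]eq_bigr => j _ do rewrite /= derivZ derivZ !hornerZ mulrCA.
rewrite -mulr_sumr -(mulr_natr 2 (2 * v)) natrM; set S := \sum_(_ <= _ < _) _.
by rewrite -[RHS]/(2 * 4^-1 * (2 * (2 * v%:R) + - 2^-1 * (4 * S))); field.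
Qed.

Lemma delannoy_pow2 (a : nat) : (0 < a)%N -> let n : int := (2 ^ a)%N%:Z in
  exists s t : int, (delannoy (2 ^ a))%:Z = 1 + n ^+ 2 * s /\
    (delannoy (2 ^ a).-1)%:Z = 4 * n ^+ 2 * t - (delannoy (2 ^ a))%:Z.
Proof.
move=> a_gt0 n; have em : (2 ^ a = (2 ^ a).-1.+1)%N by rewrite prednK ?expn_gt0.
have /dvdzP[s hs] := delannoy_mod a_gt0 em; have /dvdzP[t ht] := delannoyD_mod a_gt0 em.
move: hs ht; rewrite -em expnD mulnC expnM => hs ht; exists s, t.
have n2 : ((2 ^ a) ^ 2)%N%:Z = n ^+ 2 by rewrite /n -!natz natrX.
move: hs ht; rewrite PoszM n2 => hs ht; split.
  by rewrite -(subrK 1 (delannoy _)%:Z) hs; ring.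
by rewrite -[LHS](addKr (delannoy (2 ^ a))%:Z) ht; ring.
Qed.

Lemma dpolyN2_pow2 (a : nat) : (0 < a)%N ->
  dpoly (-2) (2 ^ a) = (delannoy (2 ^ a))%:Z /\
  dpoly (-2) (2 ^ a).-1 = - (delannoy (2 ^ a).-1)%:Z.
Proof.
move=> a_gt0; have odd_m : odd (2 ^ a).-1 by rewrite (@odd_pred_pow2 a) ?prednK ?expn_gt0.
rewrite !delannoy_sign -[in (-1) ^+ (2 ^ a)](@prednK (2 ^ a)) ?expn_gt0 //.
by rewrite exprS -signr_odd odd_m expr1 mulN1r opprK mulN1r opprK mul1r.
Qed.

Lemma horner_sqr_pm1 (P : {poly int}) (n : int) : exists r1 r2 : int,
  P.[(2 * n + 1) ^+ 2] = P.[1] + 4 * n * (n + 1) * P^`().[1] + 16 * n ^+ 2 * r1 /\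
  P.[(2 * n - 1) ^+ 2] = P.[1] + 4 * n * (n - 1) * P^`().[1] + 16 * n ^+ 2 * r2.
Proof.
have [r1 h1] := horner_taylor1 P 1 (4 * n * (n + 1)).
have [r2 h2] := horner_taylor1 P 1 (4 * n * (n - 1)).
exists ((n + 1) ^+ 2 * r1), ((n - 1) ^+ 2 * r2).
rewrite (_ : (2 * n + 1) ^+ 2 = 1 + 4 * n * (n + 1)); last by ring.
rewrite (_ : (2 * n - 1) ^+ 2 = 1 + 4 * n * (n - 1)); last by ring.
by rewrite h1 h2; split; ring.
Qed.

Theorem theorem1p3 (v : nat) :
  (exists r : int,
     rho v = r%:~R /\ ~~ (2 %| r)%Z /\
     forall a : nat, (0 < a)%N ->
       let n : int := (2 ^ a)%N%:Z in
       ((\sum_(k < 2 ^ a) ((2 * k + 1) ^ (2 * v + 1) * delannoy k)%N%:Z)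
          = r * n %[mod n ^+ 3])%Z) /\
  (exists rt : int,
     rhot v = rt%:~R /\ (2 %| rt)%Z /\
     forall a : nat, (0 < a)%N ->
       let n : int := (2 ^ a)%N%:Z in
       ((\sum_(k < 2 ^ a) (-1) ^+ k * ((2 * k + 1) ^ (2 * v + 1) * delannoy k)%N%:Z)
          = rt * n ^+ 2 %[mod n ^+ 3])%Z).
Proof.
split.
  (* Here x = 1, and the constant 1 is read as 2/2, so [m = 2]. *)
  have hz : delannoy_family ((1%:~R : rat))^-1 (fun v => (-2) *: y v) := delannoy_family_y.
  have [|G hG] := @delannoy_family_int 2 (fun v => (-2) *: y v) _ v.
    by rewrite (_ : _ / _ = 1%:~R^-1 :> rat).
  move: hG; set P := 'X^v + _ => hP.
  exists P.[1]; split; first by rewrite rhoE hP (@horner_intpoly _ 1) ?expr1n //; ring.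
  split.
    by rewrite /P hornerD hornerXn expr1n hornerZ rpredDr // dvdz_mulr.
  move=> a a_gt0 n.
  have [s [t [hs ht]]] := delannoy_pow2 a_gt0; rewrite -/n in hs ht.
  have [r1 [r2 [h1 h2]]] := horner_sqr_pm1 P n.
  have := @sum_delannoy_family 1 _ v P isT hz hP (2 ^ a).
  have -> : \sum_(k < 2 ^ a) ((2 * k + 1) ^ (2 * v + 1))%N%:Z * dpoly 1 k =
            \sum_(k < 2 ^ a) ((2 * k + 1) ^ (2 * v + 1) * delannoy k)%N%:Z.
    by apply: eq_bigr => k _; rewrite PoszM delannoyE.
  rewrite -!delannoyE -/n h1 h2 ht hs.
  set S := \sum_(_ < _) _; set p := P.[1]; set q := P^`().[1] => hS.
  apply/eqP; rewrite eqz_mod_dvd; apply/dvdzP.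
  (* The linear Taylor terms in 4n cancel in P((2n+1)^2) + P((2n-1)^2), so -2 times the sum is -2pn
     plus a multiple of 2n^3; the witness is the negated quotient after division by 2. *)
  exists (- (p * (2 * t - s) + 2 * q * (4 * n ^+ 2 * t - 2 * (1 + n ^+ 2 * s) + 4 * n * t)
    + 8 * (r1 * (4 * n ^+ 2 * t - (1 + n ^+ 2 * s)) - r2 * (1 + n ^+ 2 * s)))).
  by apply: (@mulfI _ (- (2 * 1))) => //; rewrite mulrBr hS; ring.
(* Here x = -2, and the constant -1/2 gives [m = -1]. *)
have hz : delannoy_family ((-2)%:~R : rat)^-1 (fun v => 4 *: yt v).
  by rewrite (_ : _^-1 = - 2^-1) //; apply: delannoy_family_yt.
have [|G hG] := @delannoy_family_int (-1) (fun v => 4 *: yt v) _ v.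
  by rewrite (_ : _ / _ = (-2)%:~R^-1 :> rat).
move: hG; set P := 'X^v + _ => hP.
exists (2 * P^`().[1]); split.
  have : (4 *: yt v)^`().[-1] = 4 * (P^`().[1])%:~R by rewrite hP deriv_intpoly.
  by rewrite derivZ hornerZ => /mulfI e; rewrite rhotE e // rmorphM.
split; first exact: dvdz_mulr.
move=> a a_gt0 n.
have [s [t [hs ht]]] := delannoy_pow2 a_gt0; rewrite -/n in hs ht.
have [r1 [r2 [h1 h2]]] := horner_sqr_pm1 P n.
have := @sum_delannoy_family (-2) _ v P isT hz hP (2 ^ a).
have -> : \sum_(k < 2 ^ a) ((2 * k + 1) ^ (2 * v + 1))%N%:Z * dpoly (-2) k =
    \sum_(k < 2 ^ a) (-1) ^+ k * ((2 * k + 1) ^ (2 * v + 1) * delannoy k)%N%:Z.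
  by apply: eq_bigr => k _; rewrite PoszM delannoy_sign mulrCA signrMK.
have [-> ->] := dpolyN2_pow2 a_gt0.
rewrite -/n h1 h2 ht hs.
set S := \sum_(_ < _) _; set p := P.[1]; set q := P^`().[1] => hS.
apply/eqP; rewrite eqz_mod_dvd; apply/dvdzP.
(* The signs now produce P((2n+1)^2) - P((2n-1)^2), where [p] cancels and 8nq remains. Dividing by
   -2x = 4 is possible because the error in D_n + D_(n-1) is a multiple of 4n^2. *)
exists (- (t * p + q * (4 * n ^+ 2 * t + 4 * n * t - 2 * n * s)
  + 4 * (r1 * (4 * n ^+ 2 * t - (1 + n ^+ 2 * s)) + r2 * (1 + n ^+ 2 * s)))).
by apply: (@mulfI _ (- (2 * -2))) => //; rewrite mulrBr hS; ring.
Qed.
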